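(* Let $\mathcal H_1,\mathcal H_2$ be Banach spaces, $\Theta$ a locally compact space, $\Theta\ni z\mapsto T_z\in\mathcal C(\mathcal H_1,\mathcal H_2)$ a function, and $z_0\in\Theta$. Suppose that there exist an open set $\Theta_0$ with $z_0\in\Theta_0\subset\Theta$, a Banach space $\mathcal K$ and a function $\Theta_0\ni z\mapsto W_z\in\mathcal B(\mathcal K,\mathcal H_1)$ such that $W_z$ maps $\mathcal K$ bijectively onto $\mathrm{Dom}(T_z)$ for all $z\in\Theta_0$, $T_zW_z\in\mathcal B(\mathcal K,\mathcal H_2)$ for all $z\in\Theta_0$, and both $z\mapsto W_z$ and $z\mapsto T_zW_z$ are continuous (in operator norm) at $z_0$. Then $z\mapsto T_z$ is continuous at $z_0$ in the gap topology.
   Context: $\mathcal B(\cdot,\cdot)$ denotes bounded everywhere defined operators; $\mathcal C(\mathcal H_1,\mathcal H_2)$ denotes closed operators $T$ from a linear subspace $\mathrm{Dom}(T)\subset\mathcal H_1$ (not necessarily dense) to $\mathcal H_2$. The graph of $T$ is $\mathrm{Gr}(T)=\{(x,Tx):x\in\mathrm{Dom}(T)\}\subset\mathcal H_1\oplus\mathcal H_2$. For a Banach space $\mathcal H$, $\mathrm{Grass}(\mathcal H)$ is the set of its closed subspaces; with $\delta(\mathcal X,\mathcal Y)=\sup\{\mathrm{dist}(x,\mathcal Y): x\in\mathcal X,\ \|x\|\le 1\}$ and $\hat\delta(\mathcal X,\mathcal Y)=\max(\delta(\mathcal X,\mathcal Y),\delta(\mathcal Y,\mathcal X))$, the gap topology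 on $\mathrm{Grass}(\mathcal H)$ is the weakest topology for which $\delta$ is continuous on $\mathrm{Grass}(\mathcal H)\times\mathrm{Grass}(\mathcal H)$ (convergence $\mathcal X_z\to\mathcal X_{z_0}$ amounts to $\hat\delta(\mathcal X_z,\mathcal X_{z_0})\to0$). The gap topology on $\mathcal C(\mathcal H_1,\mathcal H_2)$ is the one transported from $\mathrm{Grass}(\mathcal H_1\oplus\mathcal H_2)$ by the map $T\mapsto\mathrm{Gr}(T)$. *)

(* Defs.v *)
From HB Require Import structures.
From mathcomp Require Import all_boot all_order all_algebra.
From mathcomp Require Import all_classical all_reals all_analysis.
From mathcomp Require Import complex.

Set Implicit Arguments.
Unset Strict Implicit.
Unset Printing Implicit Defensive.

Import Order.TTheory GRing.Theory Num.Theory.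
Import numFieldNormedType.Exports.

Local Open Scope classical_set_scope.
Local Open Scope ring_scope.

(* Banach spaces are taken over the reals or over the complex numbers. *)
Variant real_or_complex (R : realType) : numFieldType -> Prop :=
| RealScalars : real_or_complex R R
| ComplexScalars : real_or_complex R R[i].

(* In a [normedModType K] the norm has values in K.  Over R[i], the order of
   the numFieldType K relates z to w when w - z is real and nonnegative; a bound
   of a nonempty set of real numbers is therefore real, so that [supremum] and
   [infimum] are the ones of the real line in both cases. *)

Section BoundedOperators.
Context {K : numFieldType} {V W : normedModType K}.

Definition bounded_op (f : V -> W) : Prop :=
  linear f /\ exists M : K, forall x, `|f x| <= M * `|x|.

Definition opnorm (f : V -> W) : K :=
  supremum 0 [set `|f x| | x in [set x : V | `|x| <= 1]].

End BoundedOperators.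

Section Grassmannian.
Context {K : numFieldType}.

Record Grass (V : normedModType K) := MkGrass {
  Grass_set :> set V ;
  Grass_submod : submod_closed [in Grass_set] ;
  Grass_closed : closed Grass_set }.

Context {V : normedModType K}.

Definition dist (x : V) (Y : set V) : K :=
  infimum 0 [set `|x - y| | y in Y].

Definition delta (X Y : Grass V) : K :=
  supremum 0 [set dist x Y | x in X `&` [set x | `|x| <= 1]].

End Grassmannian.

Definition is_topology {T : Type} (op : set_system T) : Prop :=
  [/\ op setT, setI_closed op &
      forall (I : Type) (f : I -> set T),
        (forall i, op (f i)) -> op (\bigcup_i f i)].

Section GapTopology.
Context {K : numFieldType} (V : normedModType K).

Definition delta_continuous (op : set_system (Grass V)) : Prop :=
  forall X Y : Grass V,
    (fun p : Grass V * Grass V => delta p.1 p.2)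
      @ filter_prod (nbhs_of_open op X) (nbhs_of_open op Y) --> delta X Y.

(* The weakest topology for which delta is continuous on the product, as the
   intersection of all such topologies (delta is continuous for it as well). *)
Definition gap_open : set_system (Grass V) :=
  [set U | forall op, is_topology op -> delta_continuous op -> op U].

Let gap_openT : gap_open setT.
Proof. by move=> op []. Qed.

Let gap_openI : setI_closed gap_open.
Proof.
move=> A B hA hB op top cop; case: (top) => _ opI _.
exact: opI (hA _ top cop) (hB _ top cop).
Qed.

Let gap_open_bigU (I : Type) (f : I -> set (Grass V)) :
  (forall i, gap_open (f i)) -> gap_open (\bigcup_i f i).
Proof.
by move=> hf op top cop; case: (top) => _ _ opU; apply: opU => i; exact: hf.
Qed.

HB.instance Definition _ := gen_eqMixin (Grass V).
HB.instance Definition _ := gen_choiceMixin (Grass V).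
HB.instance Definition _ :=
  isOpenTopological.Build (Grass V) gap_openT gap_openI gap_open_bigU.

End GapTopology.

Section ClosedOperators.
Context {K : numFieldType}.

(* An operator defined on [dom] is represented by a total function; [op_out]
   makes this representation unique. *)
Record closed_op (H1 H2 : normedModType K) := MkClosedOp {
  dom : set H1 ;
  op_fun :> H1 -> H2 ;
  dom_submod : submod_closed [in dom] ;
  op_linear : forall (a : K) (x y : H1), dom x -> dom y ->
    op_fun (a *: x + y) = a *: op_fun x + op_fun y ;
  op_out : forall x, ~ dom x -> op_fun x = 0 ;
  op_closed : closed [set (x, op_fun x) | x in dom] }.

Context (H1 H2 : normedModType K).

Let Gr_submod (T : closed_op H1 H2) :
  submod_closed [in [set (x, T x) | x in dom T]].
Proof.
have [d0 dZ] := dom_submod T; split.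
  rewrite inE; exists 0; first by rewrite -in_setE; exact: d0.
  have /set_mem D0 := d0.
  have := op_linear 1 D0 D0.
  by rewrite !scale1r addr0 => /eqP; rewrite addrC -subr_eq subrr eq_sym => /eqP ->.
move=> a _ _ /set_mem[x Dx <-] /set_mem[y Dy <-]; apply/mem_set.
exists (a *: x + y); last by rewrite op_linear.
by rewrite -in_setE; apply: dZ; exact/mem_set.
Qed.

(* The library's norm on [H1 * H2] is the maximum of the two norms. *)
Definition Gr (T : closed_op H1 H2) : Grass (H1 * H2)%type :=
  MkGrass (@Gr_submod T) (op_closed (c := T)).

HB.instance Definition _ := gen_eqMixin (closed_op H1 H2).
HB.instance Definition _ := gen_choiceMixin (closed_op H1 H2).
HB.instance Definition _ :=
  Topological.copy (closed_op H1 H2) (initial_topology Gr).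

End ClosedOperators.

(* Main.v *)
(* The map w_z k = (W_z k, T_z W_z k) is a bounded linear injection of K onto
   the graph of T_z, and w_z -> w_{z0} in operator norm.  The graph of T_{z0}
   being closed, the bounded inverse theorem gives |k| <= C |w_{z0} k|, and for
   z close to z0 also |k| <= 2 C |w_z k|.  Since w_z k and w_{z0} k are points
   of the two graphs at distance at most |w_z - w_{z0}| |k|, both one-sided gaps
   are at most 2 C |w_z - w_{z0}|.  That small one-sided gaps amount to
   convergence in the gap topology rests on the weak triangle inequality
   1 + delta(X, Z) <= (1 + delta(X, Y)) (1 + delta(Y, Z)).  The bounded inverse
   theorem follows from Baire's theorem relative to the closed range. *)
Require Import Defs.
From HB Require Import structures.
From mathcomp Require Import all_boot all_order all_algebra.
From mathcomp Require Import all_classical all_reals all_analysis.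
From mathcomp Require Import ring zify complex.

Set Implicit Arguments.
Unset Strict Implicit.
Unset Printing Implicit Defensive.

Import Order.TTheory GRing.Theory Num.Theory.
Import numFieldNormedType.Exports.

Local Open Scope classical_set_scope.
Local Open Scope ring_scope.

(** * Suprema and infima over real or complex scalars *)

Section Scalars.
Context {R : realType} {F : numFieldType}.
Hypothesis hF : real_or_complex R F.

(** Nonnegative elements of [R[i]] are real, so [complex.Re] carries [E] faithfully to the real
    line; an upper bound dominates an element of [E] and is thus real too. *)
Lemma has_supremum (E : set F) : E !=set0 -> (forall x, E x -> 0 <= x) ->
  ubound E !=set0 -> supremums E !=set0.
Proof.
case: hF E => E [x Ex] E0 [M EM].
  have hsE : has_sup E by split; [exists x|exists M].
  exists (sup E); split; first by move=> y Ey; exact: sup_upper_bound.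
  by move=> y Ey; apply: ge_sup => //; exists x.
have realE (y : R[i]) : 0 <= y -> (complex.Re y)%:C%C = y.
  by move=> y0; rewrite RRe_real// ger0_real.
have M0 : 0 <= M by rewrite (le_trans (E0 _ Ex))// EM.
pose G := [set complex.Re y | y in E].
have GN0 : G !=set0 by exists (complex.Re x), x.
have hsG : has_sup G.
  split=> //; exists (complex.Re M) => _ [y Ey <-].
  by rewrite -lecR (realE _ M0) realE; [exact: EM|exact: E0].
exists (sup G)%:C%C; split=> [y Ey|y yE].
  rewrite -(realE y (E0 _ Ey)) lecR; apply: sup_upper_bound => //.
  by exists y.
have y0 : 0 <= y by rewrite (le_trans (E0 _ Ex))// yE.
rewrite -(realE y)// lecR; apply: ge_sup => // _ [t Et <-].
by rewrite -lecR (realE _ y0) realE; [exact: yE|exact: E0].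
Qed.

Lemma supremumP (x0 : F) (E : set F) : E !=set0 -> (forall x, E x -> 0 <= x) ->
  ubound E !=set0 -> supremums E (supremum x0 E).
Proof.
move=> EN0 E0 EM; have [s Es] := has_supremum EN0 E0 EM.
rewrite /supremum; case: ifPn => [/eqP E_eq0|_]; last first.
  by apply: xgetPex; exists s.
by move: EN0; rewrite E_eq0 => -[].
Qed.

(** The infimum is the supremum of the nonnegative lower bounds. Any other lower bound is real,
    being comparable with a point of [E], hence negative. *)
Lemma has_infimum (E : set F) : E !=set0 -> (forall x, E x -> 0 <= x) ->
  infimums E !=set0.
Proof.
move=> [x Ex] E0; pose L := [set l | lbound E l /\ 0 <= l].
have L0 : L 0 by split.
have [|l [] //||s [Ls sL]] := @has_supremum L; first by exists 0.
  by exists x => l [El _]; exact: El.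
exists s; split=> [y Ey|t tE]; first by apply: sL => l [+ _]; apply.
have tr : t \is Num.real.
  rewrite -(subKr x t); apply: realB; apply: ger0_real; first exact: E0.
  by rewrite subr_ge0; exact: tE.
by have [t0|/ltW t0] := real_ge0P tr; [|apply: (le_trans t0)]; exact: Ls.
Qed.

Lemma infimumP (x0 : F) (E : set F) : E !=set0 -> (forall x, E x -> 0 <= x) ->
  infimums E (infimum x0 E).
Proof.
move=> EN0 E0; have [s Es] := has_infimum EN0 E0.
rewrite /infimum; case: ifPn => [/eqP E_eq0|_]; last first.
  by apply: xgetPex; exists s.
by move: EN0; rewrite E_eq0 => -[].
Qed.

Lemma real_or_complex_archi (x : F) : 0 <= x -> exists n : nat, x <= n%:R.
Proof.
case: hF x => x x0; first by exists (Num.truncn x).+1; rewrite ltW ?truncnS_gt.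
exists (Num.truncn (complex.Re x)).+1.
rewrite -(RRe_real (ger0_real x0)) -(rmorph_nat (real_complex R)) lecR.
by rewrite ltW ?truncnS_gt.
Qed.

End Scalars.

(** Replaces a minimum in a partially ordered field: positive scalars are real, hence comparable. *)
Lemma common_lower_bound (F : numFieldType) (a b : F) : 0 < a -> 0 < b ->
  exists c, [/\ 0 < c, c <= a & c <= b].
Proof.
move=> a0 b0; have [ab|/ltW ba] := real_leP (gtr0_real a0) (gtr0_real b0).
  by exists a.
by exists b.
Qed.

(** * Linear maps and operator norms *)

Section LinearFunctions.
Context {F : numFieldType} {V W : normedModType F} (f : V -> W).
Hypothesis lf : linear f.

Let g : {linear V -> W} := HB.pack f (GRing.isLinear.Build _ _ _ _ f lf).

Lemma linear_fun0 : f 0 = 0. Proof. exact: (linear0 g). Qed.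

Lemma linear_funB x y : f (x - y) = f x - f y.
Proof. exact: (linearB g). Qed.

Lemma linear_funZ a x : f (a *: x) = a *: f x.
Proof. exact: (linearZ_LR g). Qed.

End LinearFunctions.

Lemma bounded_opB (F : numFieldType) (V W : normedModType F) (f g : V -> W) :
  bounded_op f -> bounded_op g -> bounded_op (fun x => f x - g x).
Proof.
move=> [lf [M fM]] [lg [N gN]]; split=> [a x y|].
  by rewrite lf lg scalerBr opprD addrACA.
exists (M + N) => x.
by rewrite mulrDl (le_trans (ler_normB _ _))// lerD.
Qed.

(** On the zero space the constant of [bounded_op] is arbitrary, possibly not real; its modulus
    always serves. *)
Lemma bounded_op_ge0 (F : numFieldType) (V W : normedModType F) (f : V -> W) :
  bounded_op f -> exists2 M : F, 0 <= M & forall x, `|f x| <= M * `|x|.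
Proof.
move=> [_ [M fM]]; exists `|M| => // x.
rewrite -[`|x|]normr_id -normrM (le_trans (fM x))// real_ler_norm//.
by rewrite ger0_real// (le_trans _ (fM x)).
Qed.

Section OperatorNorm.
Context {R : realType} {F : numFieldType} {V W : normedModType F}.
Hypothesis hF : real_or_complex R F.

Lemma ler_opnorm1 (f : V -> W) x : bounded_op f -> `|x| <= 1 ->
  `|f x| <= opnorm f.
Proof.
move=> /bounded_op_ge0[M M0 fM] x1.
have [|||+ _] :=
  @supremumP _ _ hF 0 [set `|f x| | x in [set x : V | `|x| <= 1]].
- by exists `|f x|, x.
- by move=> _ [y _ <-].
- by exists M => _ [y /= y1 <-]; rewrite (le_trans (fM y))// ler_piMr.
- by apply; exists x.
Qed.

Lemma opnorm_ge0 (f : V -> W) : bounded_op f -> 0 <= opnorm f.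
Proof. by move=> bf; rewrite (le_trans _ (@ler_opnorm1 f 0 bf _)) ?normr0. Qed.

Lemma ler_opnorm (f : V -> W) x : bounded_op f -> `|f x| <= opnorm f * `|x|.
Proof.
move=> bf; have [->|x0] := eqVneq x 0.
  by rewrite (linear_fun0 bf.1) !normr0 mulr0.
have nx : 0 < `|x| by rewrite normr_gt0.
have := @ler_opnorm1 f (`|x|^-1 *: x) bf.
rewrite (linear_funZ bf.1) !normrZ normfV normr_id mulVf ?gt_eqF//.
by move=> /(_ (lexx _)); rewrite mulrC ler_pdivrMr.
Qed.

End OperatorNorm.

(** * One-sided gaps and the weak triangle inequality *)

Section Gap.
Context {R : realType} {F : numFieldType} {V : normedModType F}.
Hypothesis hF : real_or_complex R F.
Implicit Types X Y Z : Grass V.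

Lemma Grass0 X : Grass_set X 0.
Proof. by have [/set_mem] := Grass_submod X. Qed.

Lemma GrassZ X a x : Grass_set X x -> Grass_set X (a *: x).
Proof.
move=> Xx; have [X0 XZ] := Grass_submod X.
by apply/set_mem; rewrite -[a *: x]addr0; apply: XZ => //; exact/mem_set.
Qed.

Lemma dist_infimums x Y :
  infimums [set `|x - y| | y in (Y : set V)] (dist x Y).
Proof.
apply: (infimumP hF) => [|_ [y _ <-]//].
by exists `|x - 0|, 0 => //; exact: Grass0.
Qed.

Lemma dist_le x Y y : Grass_set Y y -> dist x Y <= `|x - y|.
Proof. by move=> Yy; have [+ _] := dist_infimums x Y; apply; exists y. Qed.

Lemma dist_ge0 x Y : 0 <= dist x Y.
Proof. by have [_ +] := dist_infimums x Y; apply => _ [y _ <-]. Qed.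

Lemma dist_lt x Y c : dist x Y < c -> exists2 y, Grass_set Y y & `|x - y| < c.
Proof.
move=> xYc; apply: contrapT => /forall2NP noy.
have : c <= dist x Y.
  have [_ +] := dist_infimums x Y; apply => _ [y Yy <-].
  have c_real : c \is Num.real.
    by rewrite gtr0_real// (le_lt_trans (dist_ge0 x Y)).
  have [//|yc] := real_leP c_real (normr_real (x - y)).
  by have [] := noy y.
by rewrite lt_geF.
Qed.

Lemma delta_supremums X Y :
  supremums [set dist x Y | x in X `&` [set x | `|x| <= 1]] (delta X Y).
Proof.
apply: (supremumP hF) => [|_ [x _ <-]|].
- by exists (dist 0 Y), 0 => //; split; rewrite /= ?normr0//; exact: Grass0.
- exact: dist_ge0.
exists 1 => _ [x [_ /= x1] <-].
by rewrite (le_trans (@dist_le x Y 0 _)) ?subr0//; exact: Grass0.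
Qed.

Lemma delta_ge0 X Y : 0 <= delta X Y.
Proof.
rewrite (le_trans (dist_ge0 0 Y))//.
have [+ _] := delta_supremums X Y; apply; exists 0 => //.
by split; rewrite /= ?normr0//; exact: Grass0.
Qed.

Lemma delta_le1 X Y : delta X Y <= 1.
Proof.
have [_ +] := delta_supremums X Y; apply => _ [x [_ /= x1] <-].
by rewrite (le_trans (@dist_le x Y 0 _)) ?subr0//; exact: Grass0.
Qed.

(** Homogeneous form of a gap bound, which composes along a chain of subspaces. For [0 <= c] it lies
    between [delta X Y < c] and [delta X Y <= c], as the infimum in [dist] need not be attained. *)
Definition approximable X Y (c : F) :=
  forall x, Grass_set X x -> exists2 y, Grass_set Y y & `|x - y| <= c * `|x|.

Lemma delta_lt_approximable X Y c : delta X Y < c -> approximable X Y c.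
Proof.
move=> XYc x Xx; have [->|x0] := eqVneq x 0.
  by exists 0; rewrite ?subr0 ?normr0 ?mulr0//; exact: Grass0.
have nx : 0 < `|x| by rewrite normr_gt0.
have [|y Yy xyc] := @dist_lt (`|x|^-1 *: x) Y c.
  apply: le_lt_trans XYc; have [+ _] := delta_supremums X Y; apply.
  exists (`|x|^-1 *: x) => //; split; first exact: GrassZ.
  by rewrite /= normrZ normfV normr_id mulVf ?gt_eqF.
exists (`|x| *: y); first exact: GrassZ.
rewrite -[X in `|X - _|](scale1r x) -(divff (lt0r_neq0 nx)) -scalerA -scalerBr.
by rewrite normrZ normr_id mulrC ler_pM2r// ltW.
Qed.

Lemma approximable_delta_le X Y c : 0 <= c -> approximable X Y c ->
  delta X Y <= c.
Proof.
move=> c0 XYc; have [_ +] := delta_supremums X Y; apply => _ [x [Xx x1] <-].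
have [y Yy xyc] := XYc x Xx.
by rewrite (le_trans (dist_le _ Yy))// (le_trans xyc)// ler_piMr.
Qed.

(** The error is at most [a * |x| + b * |y|], and [|y| <= (1 + a) * |x|]. *)
Lemma approximable_trans X Y Z a b : 0 <= b ->
  approximable X Y a -> approximable Y Z b ->
  approximable X Z ((1 + a) * (1 + b) - 1).
Proof.
move=> b0 XYa YZb x Xx; have [y Yy xya] := XYa x Xx.
have [z Zz yzb] := YZb y Yy.
exists z => //.
have nyx : `|y| <= (1 + a) * `|x|.
  by rewrite -[y](subKr x) mulrDl mul1r (le_trans (ler_normB _ _))// lerD.
rewrite (le_trans (ler_distD y _ _))//.
have -> : ((1 + a) * (1 + b) - 1) * `|x| =
    a * `|x| + b * ((1 + a) * `|x|) by ring.
by rewrite lerD// (le_trans yzb)// ler_wpM2l.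
Qed.

(** The chain [X'], [X], [Y], [Y'] costs [(1 + e) * (1 + delta X Y + e) * (1 + e) - 1]. As
    [delta X Y] and [e] are at most 1, this exceeds [delta X Y] by at most [10 * e]. *)
Lemma delta_lt_perturb X X' Y Y' e : 0 < e -> e <= 1 ->
  delta X' X < e -> delta Y Y' < e -> delta X' Y' <= delta X Y + 10%:R * e.
Proof.
move=> e0 e1 X'Xe YY'e; have d0 := delta_ge0 X Y; have d1 := delta_le1 X Y.
have XYd : approximable X Y (delta X Y + e).
  by apply: delta_lt_approximable; rewrite ltrDl.
have X'Y := approximable_trans (addr_ge0 d0 (ltW e0))
  (delta_lt_approximable X'Xe) XYd.
have := approximable_trans (ltW e0) X'Y (delta_lt_approximable YY'e).
set c := (X in approximable _ _ X) => X'Y'.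
have c_ge0 : 0 <= c.
  have -> : c = delta X Y + e + e + e + e * (delta X Y + e) *+ 2 +
      e * e * (1 + delta X Y + e) by rewrite /c; ring.
  have {e1}e0 := ltW e0.
  have de0 : 0 <= delta X Y + e by rewrite addr_ge0.
  by rewrite !(addr_ge0, mulrn_wge0, mulr_ge0).
apply: (le_trans (approximable_delta_le c_ge0 X'Y')).
rewrite -subr_ge0.
have -> : delta X Y + 10%:R * e - c =
    e * ((1 - delta X Y) * (2 + e) + (1 - e) * (5 + e)) by rewrite /c; ring.
have {}e0 := ltW e0; rewrite -subr_ge0 in e1; rewrite -subr_ge0 in d1.
by rewrite mulr_ge0// addr_ge0// mulr_ge0// addr_ge0.
Qed.

End Gap.

(** * Completeness and limits of Cauchy sequences *)

Definition cauchy_complete (U : uniformType) :=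
  forall G : set_system U, ProperFilter G -> cauchy G -> exists l : U, G --> l.

Lemma completeType_cauchy_complete (U : completeType) : cauchy_complete U.
Proof. by move=> G GG /cauchy_cvg/cvg_ex. Qed.

Lemma prod_cauchy_complete (F : numFieldType) (U V : pseudoMetricType F) :
  cauchy_complete U -> cauchy_complete V -> cauchy_complete (U * V)%type.
Proof.
move=> cU cV G GG /cauchyP Gcauchy.
have /cU[u Gu] : cauchy (fst @ G).
  apply/cauchyP => e e0; have [x Gx] := Gcauchy e e0; exists x.1.
  by apply: (@filterS _ G _ _ _ _ Gx) => y [].
have /cV[v Gv] : cauchy (snd @ G).
  apply/cauchyP => e e0; have [x Gx] := Gcauchy e e0; exists x.2.
  by apply: (@filterS _ G _ _ _ _ Gx) => y [].
exists (u, v) => A /(cvg_pair Gu Gv).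
by rewrite !nbhs_simpl /=; apply: filterS => -[].
Qed.

(** A whole tail of [u] lies in the closed ball of radius [r n] about [u n], hence so does the
    limit. *)
Lemma cvg_modulus (F : numFieldType) (V : normedModType F)
    (u : nat -> V) (r : nat -> F) :
  cauchy_complete V ->
  (forall n m, (n <= m)%N -> `|u m - u n| <= r n) ->
  (forall e, 0 < e -> exists n, r n < e) ->
  exists2 l, u @ \oo --> l & forall n, `|l - u n| <= r n.
Proof.
move=> cV ur r0.
have /cV[l ul] : cauchy (u @ \oo).
  apply: cauchy_exP => e /r0[n rne].
  exists (u n); exists n => // m /= nm.
  by rewrite -ball_normE /ball_/= distrC (le_lt_trans (ur _ _ nm)).
exists l => // n.
have rn0 : r n \is Num.real by rewrite ger0_real// (le_trans _ (ur n n _)).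
have [//|rl] := real_leP (normr_real (l - u n)) rn0.
have /cvgrPdist_lt/(_ (`|l - u n| - r n)) := ul.
rewrite subr_gt0 => /(_ rl)[N _ /(_ (maxn N n))/(_ (leq_maxl _ _)) /=].
rewrite ltrBrDr => /(le_lt_trans (lerD (lexx _) (ur _ _ (leq_maxr N n)))).
by move=> /(le_lt_trans (ler_distD _ _ _)); rewrite ltxx.
Qed.

(** * Baire's theorem relative to a closed set *)

Section ClosedCover.
Context {R : realType} {F : numFieldType}.
Hypothesis hF : real_or_complex R F.

Lemma divn_small (B e : F) : 0 <= B -> 0 < e -> exists n : nat, B / n.+1%:R < e.
Proof.
move=> B0 e0; have [|n Ben] := real_or_complex_archi hF (x := B / e).
  by rewrite divr_ge0// ltW.
exists n; rewrite ltr_pdivrMr// mulrC -ltr_pdivrMr// (le_lt_trans Ben)//.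
by rewrite ltr_nat.
Qed.

(** Otherwise there are nested closed balls with centres in [Y], the ball [n.+1] avoiding [A n]; the
    limit of the centres lies in [Y] but in no [A n]. *)
Lemma closed_cover_interior (H : normedModType F) (Y : set H)
    (A : nat -> set H) :
  cauchy_complete H -> closed Y -> Y !=set0 -> (forall n, closed (A n)) ->
  Y `<=` \bigcup_n A n ->
  exists n y r, [/\ Y y, 0 < r & forall x, Y x -> `|x - y| <= r -> A n x].
Proof.
move=> cH cY [y0 Yy0] cA YA; apply: contrapT => noball.
have step (p : nat * (H * F)) : exists q : H * F, Y p.2.1 -> 0 < p.2.2 ->
    [/\ Y q.1, 0 < q.2, q.2 <= p.1.+1%:R^-1 &
        forall x, `|x - q.1| <= q.2 -> `|x - p.2.1| <= p.2.2 /\ ~ A p.1 x].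
  case: p => n [y r] /=.
  have [Yy|] := pselect (Y y); last by move=> nYy; exists (y, r).
  have [r0|] := pselect (0 < r); last by move=> nr0; exists (y, r).
  (* A centre within [r / 2] of [y] leaves room for a ball of radius [r / 2] inside the old one. *)
  have r20 : 0 < r / 2 by rewrite divr_gt0.
  have [x [Yx xy nAx]] : exists x, [/\ Y x, `|x - y| <= r / 2 & ~ A n x].
    apply: contrapT => nox; apply: noball; exists n, y, (r / 2).
    split=> // x Yx xy.
    by apply: contrapT => nAx; apply: nox; exists x.
  have /nbhs_normP[s /= s0 sA] : nbhs x (~` A n).
    by apply: open_nbhs_nbhs; split => //; exact: closed_openC.
  have s20 : 0 < s / 2 by rewrite divr_gt0.
  have [c [c0 cs cr]] := common_lower_bound s20 r20.
  have n0 : 0 < n.+1%:R^-1 :> F by rewrite invr_gt0.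
  have [d [d0 dc dn]] := common_lower_bound c0 n0.
  exists (x, d) => _ _; split=> //= z zx; split.
    rewrite (le_trans (ler_distD x _ _))// [leRHS](splitr r) lerD//.
    by rewrite (le_trans zx)// (le_trans dc).
  apply: sA; rewrite /ball_/= distrC (le_lt_trans zx)// (le_lt_trans dc)//.
  by rewrite (le_lt_trans cs)// gtr_pMr// invf_lt1 ?ltr1n.
have [f fP] := choice step.
pose q := fix q n := if n is m.+1 then f (m, q m) else (y0, 1).
have qP n : Y (q n).1 /\ 0 < (q n).2.
  elim: n => [//|n [Yq q0]].
  by have [] := fP (n, q n) Yq q0.
have qS n : (q n.+1).2 <= n.+1%:R^-1 /\
    forall x, `|x - (q n.+1).1| <= (q n.+1).2 ->
      `|x - (q n).1| <= (q n).2 /\ ~ A n x.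
  by have [] := fP (n, q n) (qP n).1 (qP n).2.
have nested n m x : (n <= m)%N -> `|x - (q m).1| <= (q m).2 ->
    `|x - (q n).1| <= (q n).2.
  elim: m => [|m IH]; first by rewrite leqn0 => /eqP ->.
  rewrite leq_eqVlt => /predU1P[->//|nm] xm.
  by apply: IH nm _; have [] := (qS m).2 _ xm.
have [//|n m nm|e e0|l ql lq] := @cvg_modulus _ H (fst \o q) (snd \o q).
- by apply: (nested n m) => //; rewrite /= subrr normr0 ltW// (qP m).2.
- have [n] := divn_small ler01 e0; rewrite div1r => ne.
  by exists n.+1; rewrite (le_lt_trans (qS n).1).
have Yl : Y l.
  apply: (@closed_cvg _ _ _ _ (fst \o q) Y cY _ l ql).
  by apply: nearW => n; exact: (qP n).1.
have [n _ Anl] := YA _ Yl.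
by have [] := (qS n).2 l (lq n.+1).
Qed.

End ClosedCover.

(** * The bounded inverse theorem for a closed range *)

Section BoundedBelow.
Context {R : realType} {F : numFieldType}.
Hypothesis hF : real_or_complex R F.
Context {K H : normedModType F} (w : K -> H).
Hypotheses (cK : cauchy_complete K) (cH : cauchy_complete H).
Hypotheses (bw : bounded_op w) (injw : injective w) (cw : closed (range w)).

Let lw := bw.1.

Let A (n : nat) := closure (w @` [set k | `|k| <= n%:R]).

Let AP n y e : A n y -> 0 < e -> exists2 k, `|k| <= n%:R & `|y - w k| < e.
Proof.
move=> Any e0; have [|_ [[k /= kn <-] yk]] := Any (ball y e).
  exact: nbhsx_ballx.
by exists k => //; move: yk; rewrite -ball_normE.
Qed.

(** By Baire some [A n] contains a relative ball of [range w] about [w x0]. A difference of two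
    approximants moves this ball to the origin, and scaling reaches every [w x]. *)
Lemma approximate_preimage : exists2 C : F, 0 <= C & forall x,
  exists2 k, `|k| <= C * `|w x| & `|w x - w k| <= `|w x| / 2.
Proof.
have [|||||n [y [r [[x0 _ <-] r0 rA]]]] :=
  @closed_cover_interior _ _ hF H (range w) A.
- exact: cH.
- exact: cw.
- by exists (w 0), 0.
- by move=> n; exact: closed_closure.
- move=> _ [x _ <-]; have [n xn] := real_or_complex_archi hF (normr_ge0 x).
  by exists n => //; apply: subset_closure; exists x.
exists ((n%:R + n%:R) / r); first by rewrite divr_ge0 ?addr_ge0 ?ler0n// ltW.
move=> x; have [->|x_neq0] := eqVneq x 0.
  by exists 0; rewrite ?subrr (linear_fun0 lw) !normr0 ?mulr0 ?mul0r.
have wx0 : 0 < `|w x|.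
  rewrite normr_gt0; apply: contra_neq x_neq0.
  by rewrite -[in RHS](linear_fun0 lw) => /injw.
(* With this scale [w (x0 + t *: x)] lies at distance exactly [r] from [w x0]. *)
pose t := r / `|w x|.
have t0 : 0 < t by rewrite divr_gt0.
have r40 : 0 < r / 4 by rewrite divr_gt0.
have [k1 k1n k1y] : exists2 k, `|k| <= n%:R & `|w (x0 + t *: x) - w k| < r / 4.
  apply: AP r40; apply: rA; first by exists (x0 + t *: x).
  rewrite -(linear_funB lw) addrAC subrr add0r (linear_funZ lw) normrZ.
  by rewrite gtr0_norm// divfK ?gt_eqF.
have [k2 k2n k2y] : exists2 k, `|k| <= n%:R & `|w x0 - w k| < r / 4.
  by apply: AP r40; apply: rA; [exists x0|rewrite subrr normr0 ltW].
(* The two errors [r / 4] add up to [r / 2], which division by [t] turns into half of [|w x|]. *)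
exists (t^-1 *: (k1 - k2)).
  rewrite normrZ gtr0_norm ?invr_gt0// invf_div [leRHS]mulrC.
  rewrite mulrCA [leRHS]mulrC ler_wpM2l ?divr_ge0 ?(ltW r0)//.
  by rewrite (le_trans (ler_normB _ _))// lerD.
rewrite -(linear_funB lw) -[X in w (X - _)](scalerK (lt0r_neq0 t0)).
rewrite -scalerBr (linear_funZ lw) normrZ gtr0_norm ?invr_gt0//.
rewrite invf_div mulrAC ler_pdivrMr// -mulrA ler_pM2l//.
have -> : t *: x - (k1 - k2) = (x0 + t *: x - k1) - (x0 - k2).
  rewrite !opprB -(addrA x0) (addrC k2 (- x0)) addrACA subrr add0r -addrA.
  by rewrite (addrC (- k1)).
rewrite (linear_funB lw) (le_trans (ler_normB _ _))//.
have -> : 2^-1 * r = r / 4 + r / 4 by field.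
by rewrite !(linear_funB lw) lerD// ltW.
Qed.

(* Subtracting approximate preimages repeatedly, [x] is driven to [0] along a
   series of length at most a constant times [`|w x|]. *)
Lemma bounded_below : exists2 C : F, 0 <= C & forall x, `|x| <= C * `|w x|.
Proof.
have [C C0 preimage] := approximate_preimage.
(* [s x] is the remainder after one approximate preimage is subtracted. *)
have /choice[s sP] : forall x, exists y,
    `|y - x| <= C * `|w x| /\ `|w y| *+ 2 <= `|w x|.
  move=> x; have [k kC wk] := preimage x; exists (x - k); split.
    by rewrite addrAC subrr add0r normrN.
  by rewrite (linear_funB lw) -mulr_natr -ler_pdivlMr.
have C20 : 0 <= C *+ 2 by rewrite mulrn_wge0.
have sdist k x : `|iter k s x - x| <= C *+ 2 * `|w x|.
  (* The sharper bound telescopes: since [|w (s y)|] is at most half of [|w y|], a step of length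
     [C * |w y|] is paid for by the decrease of [2 * C * |w y|]. *)
  apply: (@le_trans _ _ (C *+ 2 * (`|w x| - `|w (iter k s x)|))); last first.
    by rewrite ler_wpM2l// gerBl.
  elim: k => [|k IH]; first by rewrite /= !subrr normr0 mulr0.
  have [/= sk wsk] := sP (iter k s x).
  rewrite (le_trans (ler_distD (iter k s x) _ _))//.
  rewrite (le_trans (lerD sk IH))// -subr_ge0.
  have -> : C *+ 2 * (`|w x| - `|w (s (iter k s x))|) -
      (C * `|w (iter k s x)| + C *+ 2 * (`|w x| - `|w (iter k s x)|)) =
      C * (`|w (iter k s x)| - `|w (s (iter k s x))| *+ 2) by ring.
  by rewrite mulr_ge0// subr_ge0.
exists (C *+ 2) => // x.
pose y n := iter n s x.
have ydist n m : (n <= m)%N -> `|y m - y n| <= C *+ 2 * `|w (y n)|.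
  by move=> /subnK <-; rewrite /y iterD.
(* Halving gives more than this decay, because [n.+2 <= 2 * n.+1]. *)
have wy n : `|w (y n)| <= `|w x| / n.+1%:R.
  elim: n => [|n IH]; first by rewrite divr1.
  rewrite ler_pdivlMr//; rewrite ler_pdivlMr// in IH; apply: le_trans IH.
  rewrite (@le_trans _ _ (`|w (y n.+1)| *+ 2 * n.+1%:R))//.
    by rewrite mulrnAl -mulrnAr ler_wpM2l// -mulrnA ler_nat; lia.
  by rewrite ler_wpM2r// (sP (y n)).2.
have [||e e0|l yl ly] := @cvg_modulus _ K y (fun n => C *+ 2 * `|w (y n)|).
- exact: cK.
- exact: ydist.
- have [n ne] := divn_small hF (mulr_ge0 C20 (normr_ge0 (w x))) e0; exists n.
  by rewrite (le_lt_trans _ ne)// -mulrA ler_wpM2l.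
have [M M0 wM] := bounded_op_ge0 bw.
(* As [y 0] is [x], the estimate for [l = 0] is the claim. By injectivity it remains to see
   [w l = 0], from [|w l| <= (M * 2 * C + 1) * |w (y n)|]. *)
suff l0 : l = 0 by have := ly 0%N; rewrite l0 sub0r normrN.
apply: injw; rewrite (linear_fun0 lw); apply/eqP; apply: contraT.
rewrite -normr_gt0 => wl0.
have D0 : 0 <= M * (C *+ 2) + 1 by rewrite addr_ge0// mulr_ge0.
have [n] := divn_small hF (mulr_ge0 D0 (normr_ge0 (w x))) wl0.
rewrite -mulrA => /lt_geF <-; rewrite (le_trans _ (ler_wpM2l D0 (wy n)))//.
rewrite -[w l](subrK (w (y n))) mulrDl mul1r (le_trans (ler_normD _ _))//.
by rewrite lerD// -(linear_funB lw) (le_trans (wM _))// -mulrA ler_wpM2l.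
Qed.

End BoundedBelow.

(** * Convergence in the gap topology *)

Section GapConvergence.
Context {R : realType} {F : numFieldType} {V : normedModType F}.
Hypothesis hF : real_or_complex R F.

Lemma delta_refl (X : Grass V) : delta X X = 0.
Proof.
apply/eqP; rewrite eq_le (delta_ge0 hF) andbT.
apply: (approximable_delta_le hF) => // x Xx.
by exists x; rewrite // subrr normr0 mul0r.
Qed.

(* The sets that belong to the filter [G] as soon as they contain [X0] form a
   topology for which [delta] is continuous, hence finer than the gap
   topology. *)
Lemma cvg_gap (G : set_system (Grass V)) (X0 : Grass V) : Filter G ->
  (forall e : F, 0 < e ->
    \forall X \near G, delta X X0 < e /\ delta X0 X < e) ->
  G --> X0.
Proof.
move=> GF GX0 A [B [Bopen BX0 BA]]; apply: filterS BA _.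
pose op := [set U : set (Grass V) | U X0 -> G U].
have op_nbhs X e : 0 < e -> nbhs_of_open op X
    [set Y | delta Y X < e /\ delta X Y < e].
  move=> e0; have [->|XX0] := eqVneq X X0.
    exists [set Y | delta Y X0 < e /\ delta X0 Y < e]; split => //=.
    - by move=> _; exact: GX0.
    - by rewrite delta_refl.
  (* Every point other than [X0] is isolated in the topology [op]. *)
  exists [set X]; split => //=; first by move=> /= X0X; rewrite X0X eqxx in XX0.
  by move=> _ /= ->; rewrite delta_refl.
apply: (Bopen op) => //.
  split=> [_|U1 U2 oU1 oU2 [U10 U20]|I f of0 [i _ fi0]]; first exact: filterT.
    by apply: filterI; [exact: oU1|exact: oU2].
  by apply: filterS (of0 i fi0) => Y fiY; exists i.
move=> X Y U /nbhs_normP[e /= e0 eU].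
(* With [d <= e / 20], the perturbation [10 * d] is at most [e / 2]. *)
have e20 : 0 < e / 20 by rewrite divr_gt0.
have [d [d0 de d1]] := common_lower_bound e20 ltr01.
exists ([set Y | delta Y X < d /\ delta X Y < d],
        [set Z | delta Z Y < d /\ delta Y Z < d]) => /=.
  by split; exact: op_nbhs.
move=> [X' Y'] /= [[X'X XX'] [Y'Y YY']]; apply: eU; rewrite /ball_/=.
have de' : 10%:R * d < e.
  rewrite (le_lt_trans (ler_wpM2l _ de))//.
  have -> : 10%:R * (e / 20) = e / 2 by field.
  by rewrite ltr_pdivrMr// ltr_pMr// ltr1n.
have dr (X1 X2 : Grass V) : delta X1 X2 \is Num.real.
  exact: ger0_real (delta_ge0 hF X1 X2).
rewrite real_ltr_distl ?realB ?dr//; apply/andP; split.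
  by rewrite ltrBlDr (le_lt_trans (delta_lt_perturb hF d0 d1 X'X YY'))// ltrD2l.
by rewrite (le_lt_trans (delta_lt_perturb hF d0 d1 XX' Y'Y))// ltrD2l.
Qed.

End GapConvergence.

Lemma closed_op_cvg (F : numFieldType) (H1 H2 : normedModType F)
    (I : Type) (G : set_system I) (T : I -> closed_op H1 H2)
    (T0 : closed_op H1 H2) : Filter G ->
  Gr (T i) @[i --> G] --> Gr T0 -> T i @[i --> G] --> T0.
Proof.
move=> GF GT A [_ [[B Bopen <-] BT0 BA]].
apply: filterS BA _; apply: GT; exact: open_nbhs_nbhs.
Qed.

Lemma prod_norm_le (F : numFieldType) (U V : normedModType F) (x : U * V) c :
  `|x.1| <= c -> `|x.2| <= c -> `|x| <= c.
Proof. by rewrite prod_normE /Num.max; case: ifP. Qed.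

(** * Gaps between ranges of nearby operators *)

Section Perturbation.
Context {R : realType} {F : numFieldType} {K H : normedModType F}.
Hypothesis hF : real_or_complex R F.

Lemma delta_range_le (w w' : K -> H) (X X' : Grass H) (C e : F) :
  range w = X -> range w' = X' -> 0 <= C -> 0 <= e -> C * e <= 2^-1 ->
  (forall k, `|k| <= C * `|w k|) -> (forall k, `|w' k - w k| <= e * `|k|) ->
  delta X X' <= C * e *+ 2 /\ delta X' X <= C * e *+ 2.
Proof.
move=> wX wX' C0 e0 Ce wC ww'; have Ce0 : 0 <= C * e by rewrite mulr_ge0.
split; apply: (approximable_delta_le hF); rewrite ?mulrn_wge0// => x.
  rewrite -wX => -[k _ <-]; exists (w' k); first by rewrite -wX'; exists k.
  rewrite distrC (le_trans (ww' k))//.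
  rewrite (@le_trans _ _ (e * (C * `|w k|))) ?ler_wpM2l//.
  by rewrite mulrCA mulrA ler_wpM2r// mulr2n lerDl.
rewrite -wX' => -[k _ <-]; exists (w k); first by rewrite -wX; exists k.
(* The lower bound passes from [w] to [w']: the error [C * e * |k|] is at most half of [|k|] and is
   absorbed on the left, which doubles the constant. *)
have kC : `|k| <= C *+ 2 * `|w' k|.
  have : `|k| <= C * `|w' k| + 2^-1 * `|k|.
    rewrite (le_trans (wC k))// -[w k](subKr (w' k)).
    rewrite (le_trans (ler_wpM2l C0 (ler_normB _ _)))// mulrDr lerD2l.
    by rewrite (le_trans (ler_wpM2l C0 (ww' k)))// mulrA ler_wpM2r.
  rewrite -lerBlDr (_ : _ - _ = `|k| / 2) ?ler_pdivrMr//; last by field.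
  by rewrite mulrnAl mulr_natr.
rewrite (le_trans (ww' k))// (le_trans (ler_wpM2l e0 kC))//.
by rewrite mulrA mulrnAr [e * C]mulrC.
Qed.

End Perturbation.
Theorem proposition3p28 (R : realType) (F : numFieldType)
    (hF : real_or_complex R F)
    (H1 H2 : completeNormedModType F)
    (Theta : topologicalType) (hTheta : locally_compact [set: Theta])
    (T : Theta -> closed_op H1 H2) (z0 : Theta)
    (Theta0 : set Theta) (hTheta0 : open Theta0) (hz0 : Theta0 z0)
    (K : completeNormedModType F) (W : Theta -> K -> H1)
    (hW : forall z, Theta0 z -> bounded_op (W z))
    (hbij : forall z, Theta0 z -> set_bij [set: K] (dom (T z)) (W z))
    (hTW : forall z, Theta0 z -> bounded_op (fun k => T z (W z k)))
    (hWcont : opnorm (fun k => W z k - W z0 k) @[z --> z0] --> (0 : F))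
    (hTWcont : opnorm (fun k => T z (W z k) - T z0 (W z0 k)) @[z --> z0]
      --> (0 : F)) :
  {for z0, continuous T}.
Proof.
apply: closed_op_cvg; apply: (cvg_gap hF) => e e0.
pose w z k := (W z k, T z (W z k)).
have w_range z : Theta0 z -> range (w z) = Gr (T z).
  move=> /hbij[funW _ surjW]; apply/seteqP; split=> [_ [k _ <-]|_ [x Dx <-]].
    by exists (W z k) => //; exact: funW.
  by have [k _ <-] := surjW x Dx; exists k.
have bw : bounded_op (w z0).
  have [[lW _] [lTW _]] := (hW _ hz0, hTW _ hz0).
  have [M M0 WM] := bounded_op_ge0 (hW _ hz0).
  have [N N0 TWN] := bounded_op_ge0 (hTW _ hz0).
  split; first by move=> a k l; rewrite /w lTW lW.
  exists (M + N) => k; apply: prod_norm_le => /=.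
    by rewrite (le_trans (WM k))// ler_wpM2r// lerDl.
  by rewrite (le_trans (TWN k))// ler_wpM2r// lerDr.
have injw : injective (w z0).
  move=> k l [Wkl _]; have [_ inj _] := hbij _ hz0.
  by apply: inj; rewrite ?in_setE.
have [|||C C0 wC] := bounded_below hF _ _ bw injw _.
- exact: completeType_cauchy_complete.
- by apply: prod_cauchy_complete; exact: completeType_cauchy_complete.
- by rewrite w_range//; exact: Grass_closed.
have e40 : 0 < e / 4 by rewrite divr_gt0.
have half0 : 0 < 2^-1 :> F by rewrite invr_gt0.
have [d [d0 de d1]] := common_lower_bound e40 half0.
have C10 : 0 < C + 1 by rewrite ltr_wpDl.
(* [C] may vanish, hence the denominator [C + 1]. Then [C * r <= d], where [d <= 2^-1] meets the
   absorption condition and [d <= e / 4] makes both gaps less than [e]. *)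
pose r := d / (C + 1).
have r0 : 0 < r by rewrite divr_gt0.
have Crd : C * r <= d.
  by rewrite mulrCA ler_piMr ?(ltW d0)// ler_pdivrMr// mul1r lerDl.
move/cvgrPdist_lt : hWcont => /(_ _ r0) Wr.
move/cvgrPdist_lt : hTWcont => /(_ _ r0) TWr.
rewrite near_map; near=> z.
have z_Theta0 : Theta0 z by near: z; exact: open_nbhs_nbhs.
have bWz := bounded_opB (hW _ z_Theta0) (hW _ hz0).
have bTWz := bounded_opB (hTW _ z_Theta0) (hTW _ hz0).
have [|||||||] := @delta_range_le _ _ _ _ hF (w z0) (w z)
  (Gr (T z0)) (Gr (T z)) C r.
- exact: w_range.
- exact: w_range.
- exact: C0.
- exact: ltW.
- exact: le_trans Crd d1.
- exact: wC.
- move=> k; apply: prod_norm_le => /=.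
    rewrite (le_trans (ler_opnorm hF k bWz))// ler_wpM2r// ltW//.
    (* Brings the bound into the form [|0 - opnorm _| < r] provided by convergence to 0. *)
    rewrite -[ltLHS](ger0_norm (opnorm_ge0 hF bWz)) -normrN -[- _]add0r.
    by near: z.
  rewrite (le_trans (ler_opnorm hF k bTWz))// ler_wpM2r// ltW//.
  rewrite -[ltLHS](ger0_norm (opnorm_ge0 hF bTWz)) -normrN -[- _]add0r.
  by near: z.
have Cre : C * r *+ 2 < e.
  rewrite (@le_lt_trans _ _ (e / 4 *+ 2)) ?lerMn2r ?(le_trans Crd)//.
  have -> : e / 4 *+ 2 = e / 2 by field.
  by rewrite ltr_pdivrMr// ltr_pMr// ltr1n.
by move=> d1z d2z; split; apply: le_lt_trans Cre.
Unshelve. all: by end_near. Qed.
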